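(* Let $\theta\in\mathbb R^q$ be a constant vector, let $\phi:\mathbb R_{\ge0}\to\mathbb R^q$ be continuous, let $$y(t)=\phi^\top(t)\theta,\qquad t\ge0,$$ and assume this linear regression equation is identifiable (defined in the context). Let $\alpha>0$, $f_0>0$, $\beta_0\ge0$, $M\ge\frac1{f_0}$, $\gamma>0$ be tuning gains and consider the estimator $$\dot{\hat\eta}(t)=\alpha F(t)\phi(t)\,[y(t)-\phi^\top(t)\hat\eta(t)],\qquad \hat\eta(0)=\eta_0\in\mathbb R^q,$$ $$\dot F(t)=-\alpha F(t)\phi(t)\phi^\top(t)F(t)+\beta(t)F(t),\qquad F(0)=\tfrac1{f_0}I_q,$$ $$\dot{\hat\theta}(t)=\gamma\,\Delta(t)\,[\mathcal Y(t)-\Delta(t)\hat\theta(t)],\qquad \hat\theta(0)=\theta_0\in\mathbb R^q,$$ $$\dot z(t)=-\beta(t)z(t),\qquad z(0)=1,$$ where $$\beta(t):=\beta_0\Big(1-\frac{\|F(t)\|}{M}\Big),\qquad \Delta(t):=\det\{I_q-z(t)f_0F(t)\},$$ $$\mathcal Y(t):=\operatorname{adj}\{I_q-z(t)f_0F(t)\}\,[\hat\eta(t)-z(t)f_0F(t)\eta_0].$$ Then, for all $f_0>0$, $\eta_0\in\mathbb R^q$ and $\theta_0\in\mathbb R^q$, the parameter error $\tilde\theta(t):=\hat\theta(t)-\theta$ satisfies $\lim_{t\to\infty}\tilde\theta(t)=0$ exponentially, i.e. there exist constants $c,\lambda>0$ with $|\tilde\theta(t)|\le c\,e^{-\lambda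 t}$ for all $t\ge0$, and all signals of the estimator ($\hat\eta$, $F$, $\hat\theta$, $z$, $\beta$, $\Delta$, $\mathcal Y$) are bounded on $[0,\infty)$. Moreover, the individual parameter errors satisfy the monotonicity condition $$|\tilde\theta_i(t_a)|\le|\tilde\theta_i(t_b)|\qquad\text{for all } t_a\ge t_b\ge0,\ i\in\{1,\dots,q\}.$$
   Context: $|\cdot|$ is the Euclidean norm, $\|\cdot\|$ the induced matrix norm, $I_q$ the $q\times q$ identity, $\operatorname{adj}$ the adjugate matrix. The linear regression equation $y(t)=\phi^\top(t)\theta$, with $y(t)\in\mathbb R$, $\phi(t)\in\mathbb R^q$, $\theta\in\mathbb R^q$, is identifiable if and only if there exist time instants $t_1,\dots,t_q\in\mathbb R_{>0}$ such that $\operatorname{rank}\,[\phi(t_1)\,|\,\phi(t_2)\,|\cdots|\,\phi(t_q)]=q$. *)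

(* Defs.v *)
From mathcomp Require Export all_boot all_order all_algebra.
From mathcomp Require Export all_classical all_reals all_analysis.

Set Implicit Arguments.
Unset Strict Implicit.
Unset Printing Implicit Defensive.

Import Order.TTheory GRing.Theory Num.Theory.
Import numFieldNormedType.Exports.

Local Open Scope classical_set_scope.
Local Open Scope ring_scope.

(* The library norm `|x| on matrices is the maximum of the absolute values of
   the entries, hence the separate Euclidean norm and its induced norm. *)
Definition enorm (R : realType) (q : nat) (x : 'cV[R]_q) : R :=
  Num.sqrt (\sum_(i < q) x i 0 ^+ 2).

Definition opnorm (R : realType) (q : nat) (A : 'M[R]_q) : R :=
  sup [set enorm (A *m x) | x in [set x : 'cV[R]_q | enorm x <= 1]].

(* Derivative at t of a function regarded as defined on [0, +oo[ only: it is
   two-sided for t > 0 and one-sided (from the right) at t = 0. *)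
Definition is_derive_on_Rge0 (R : realType) (V : normedModType R)
    (f : R -> V) (t : R) (df : V) : Prop :=
  (s - t)^-1 *: (f s - f t) @[s --> within `[0, +oo[ t^'] --> df.

(* Identifiability of y(t) = phi(t)^T theta; it depends on phi only. *)
Definition identifiable (R : realType) (q : nat) (phi : R -> 'cV[R]_q) : Prop :=
  exists2 tau : 'I_q -> R, (forall j, 0 < tau j) &
    \rank (\matrix_(i < q, j < q) phi (tau j) i 0) = q.

(* Main.v *)
Require Import Defs.
From mathcomp Require Import perm ring lra.

Set Implicit Arguments.
Unset Strict Implicit.
Unset Printing Implicit Defensive.

Import Order.TTheory GRing.Theory Num.Theory.
Import numFieldNormedType.Exports.

Local Open Scope classical_set_scope.
Local Open Scope ring_scope.

(** The change of variable that makes the estimator transparent is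
    [G := z f0 F].  The forgetting factor [beta] cancels in its equation,
    leaving the Riccati equation [G' = - k G phi phi^T G] with [G 0 = I] and
    [k := alpha / (z f0)].  Its solution is the inverse of [I + S], where
    [S t] is the integral of [k phi phi^T] over [[0, t]] ([riccati_inverse]).
    The error [heta - theta] solves the linear equation
    [e' = - (k G phi phi^T) e], which [G (eta0 - theta)] solves as well with
    the same initial value, so [heta - theta = G (eta0 - theta)]
    ([riccati_propagator]).  Hence
    [heta - G eta0 = (I - G) theta], and multiplying by the adjugate of
    [I - G] gives [Y = Delta theta] with [Delta = det (I - G)]: each
    coordinate [w] of the error of [htheta] obeys the decoupled scalar
    equation [w' = - gamma Delta ^ 2 w].  Monotonicity is immediate.

    For the exponential rate, [Delta] has to stay away from zero.
    Identifiability makes [S T] positive definite for some [T]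
    ([gramian_coercive]), and [S] is nondecreasing, so [S t >= c I] with the
    same [c] for all [t >= T].  Then [I - G = G S] has the inverse
    [I + S^-1], whose entries are bounded, so the determinant of that
    inverse is bounded and [Delta] is bounded below
    ([det_sub_inverse_ge]).

    Boundedness rests on [opnorm (F t) <= M].  The inverse of [F] is
    [P := z f0 (I + S)], and [opnorm F <= M] is equivalent to [P >= M^-1 I]
    ([opnorm_inverse_le], [inverse_opnorm_coercive]).  While
    [opnorm F > M], [beta] is nonpositive, so [z], hence [P], is
    nondecreasing and the inequality cannot have been lost
    ([continuous_barrier]).  It follows that [0 <= beta <= beta0] and
    [0 < z <= 1].

    Both identities for [G] are uniqueness statements for a linear equation
    with continuous coefficients; they need Gronwall's inequality only
    ([linear_ode_zero]), so that no existence theorem for differential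
    equations enters.  Likewise [z] is positive because [z] times the
    exponential of a primitive of [beta] is constant. *)

(** * Calculus on the half-line *)

(** Derivatives are only recorded for [t > 0], where they are two-sided and
    the product and chain rules apply; at [0] continuity is all that the mean
    value theorem asks for. *)
Definition evolves (R : realType) (f df : R -> R) : Prop :=
  {within `[0, +oo[, continuous f} /\
  forall t : R, 0 < t -> is_derive t 1 f (df t).

Lemma contRge0P (R : realType) (V : topologicalType) (f : R -> V) :
  {within `[0, +oo[, continuous f} <->
  (forall t : R, 0 <= t -> f s @[s --> within `[0, +oo[ (nbhs t)] --> f t).
Proof.
split=> [/subspace_continuousP h t t0|h].
  by apply: h; rewrite /= in_itv/= t0.
by apply/subspace_continuousP => t /=; rewrite in_itv/= andbT => /h.
Qed.

Lemma is_derive_on_Rge0_cvg (R : realType) (V : normedModType R)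
    (f : R -> V) (t : R) (df : V) :
  is_derive_on_Rge0 f t df -> f s @[s --> within `[0, +oo[ (nbhs t)] --> f t.
Proof.
move=> h; apply/cvgrPdist_lt => e e0.
pose D := within `[0, +oo[%classic t^'.
have h0 : (s - t) *: ((s - t)^-1 *: (f s - f t)) @[s --> D] --> (0 : V).
  rewrite -(scale0r df); apply: cvgZ; last exact: h.
  rewrite -(subrr t); apply: cvgB; last exact: cvg_cst.
  apply: cvg_trans (@cvg_id _ (nbhs t)).
  apply: cvg_trans (@cvg_within _ t^' _ _) _.
  exact: cvg_within.
move/cvgr0Pnorm_lt : h0 => /(_ e e0) /=.
rewrite /D /dnbhs !near_withinE => h0.
near=> s => s0.
have [->|st] := eqVneq s t; first by rewrite subrr normr0.
have : s != t -> s \in `[0, +oo[ ->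
   `|(s - t) *: ((s - t)^-1 *: (f s - f t))| < e by near: s.
rewrite scalerA divff ?subr_eq0// scale1r distrC; exact.
Unshelve. all: by end_near. Qed.

Lemma evolves_is_derive_on_Rge0 (R : realType) (f df : R -> R) :
  (forall t : R, 0 <= t -> is_derive_on_Rge0 f t (df t)) -> evolves f df.
Proof.
move=> h; split.
  apply/subspace_continuousP => t /=; rewrite in_itv/= andbT => t0.
  exact: is_derive_on_Rge0_cvg (h t t0).
move=> t t0.
have /= ht := h t (ltW t0).
suff H : h^-1 *: ((f \o shift t) (h *: 1) - f t) @[h --> 0^'] --> df t.
  apply: DeriveDef; first by apply/cvg_ex; exists (df t).
  exact: cvg_lim H.
apply/cvgrPdist_lt => e e0.
move/cvgrPdist_lt : ht => /(_ e e0) ht.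
rewrite /dnbhs !near_withinE in ht; have /nbhs_ballP[d /= d0 hd] := ht.
near=> x => /=.
rewrite [x *: 1]mulr1.
have := hd (x + t).
rewrite addrK; apply.
- rewrite /ball/= opprD addrCA subrr addr0 normrN.
  by near: x; exact: dnbhs0_lt.
- by rewrite -subr_eq0 addrK; near: x; exact: nbhs_dnbhs_neq.
- rewrite in_itv/= andbT.
  rewrite -lerBlDr sub0r lerNl.
  apply: (le_trans (ler_norm _)); rewrite normrN ltW//.
  by near: x; exact: dnbhs0_lt.
Unshelve. all: by end_near. Qed.

Lemma is_derive_on_Rge0_coord (R : realType) m n (A : R -> 'M[R]_(m, n)) t dA i j :
  is_derive_on_Rge0 A t dA -> is_derive_on_Rge0 (fun s => A s i j) t (dA i j).
Proof.
move=> h; rewrite /is_derive_on_Rge0.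
rewrite (_ : (fun s => _) =
  (fun M : 'M[R]_(m, n) => M i j) \o (fun s => (s - t)^-1 *: (A s - A t))).
  by apply: cvg_comp; [exact: h|exact: coord_continuous].
by apply/funext => s; rewrite /= !mxE.
Qed.

Section calculus.
Variable R : realType.
Implicit Types (f g df dg : R -> R).
Let C f := {within `[0, +oo[, continuous f}.

Lemma contRge0_cst (a : R) : C (fun=> a).
Proof. by apply/contRge0P => t _; exact: cvg_cst. Qed.

Lemma contRge0D f g : C f -> C g -> C (fun t => f t + g t).
Proof.
by move=> /contRge0P cf /contRge0P cg; apply/contRge0P => t t0;
  apply: cvgD; [exact: cf|exact: cg].
Qed.

Lemma contRge0M f g : C f -> C g -> C (fun t => f t * g t).
Proof.
by move=> /contRge0P cf /contRge0P cg; apply/contRge0P => t t0;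
  apply: cvgM; [exact: cf|exact: cg].
Qed.

Lemma contRge0_sum (I : Type) (r : seq I) (P : pred I) (F : I -> R -> R) :
  (forall i, C (F i)) -> C (fun t => \sum_(i <- r | P i) F i t).
Proof.
move=> cF; elim: r => [|i r IH].
  by under eq_fun do rewrite big_nil; exact: contRge0_cst.
under eq_fun do rewrite big_cons.
by case: (P i) => //; exact: contRge0D.
Qed.

Lemma contRge0_norm f : C f -> C (fun t => `|f t|).
Proof.
move=> /contRge0P cf; apply/contRge0P => t t0.
by apply: cvg_norm; exact: cf.
Qed.

Lemma contRge0_expR f : C f -> C (fun t => expR (f t)).
Proof.
move=> /contRge0P cf; apply/contRge0P => t t0.
by apply: (cvg_comp _ _ (cf t t0)); exact: continuous_expR.
Qed.

Lemma evolves_eq f df dg : (forall t : R, 0 < t -> df t = dg t) ->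
  evolves f df -> evolves f dg.
Proof. by move=> e [cf hf]; split=> // t t0; rewrite -e//; exact: hf. Qed.

Lemma evolves_cst (a : R) : evolves (fun=> a) (fun=> 0).
Proof. by split; [exact: contRge0_cst|move=> t _; exact: is_derive_cst]. Qed.

Lemma evolvesD f g df dg : evolves f df -> evolves g dg ->
  evolves (fun t => f t + g t) (fun t => df t + dg t).
Proof.
move=> [cf hf] [cg hg]; split; first exact: contRge0D.
by move=> t t0; apply: is_deriveD; [exact: hf|exact: hg].
Qed.

Lemma evolvesM f g df dg : evolves f df -> evolves g dg ->
  evolves (fun t => f t * g t) (fun t => df t * g t + f t * dg t).
Proof.
move=> [cf hf] [cg hg]; split; first exact: contRge0M.
move=> t t0; apply: (is_derive_eq (is_deriveM (hf t t0) (hg t t0))).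
by rewrite addrC [g t *: _]mulrC.
Qed.

Lemma evolvesZ (a : R) f df : evolves f df ->
  evolves (fun t => a * f t) (fun t => a * df t).
Proof.
move=> hf; apply: evolves_eq (evolvesM (evolves_cst a) hf) => t _.
by rewrite mul0r add0r.
Qed.

Lemma evolves_sum (I : Type) (r : seq I) (P : pred I) (F dF : I -> R -> R) :
  (forall i, evolves (F i) (dF i)) ->
  evolves (fun t => \sum_(i <- r | P i) F i t)
          (fun t => \sum_(i <- r | P i) dF i t).
Proof.
move=> hF; elim: r => [|i r IH].
  under eq_fun do rewrite big_nil.
  by under [X in evolves _ X]eq_fun do rewrite big_nil; exact: evolves_cst.
under eq_fun do rewrite big_cons.
under [X in evolves _ X]eq_fun do rewrite big_cons.
by case: (P i) => //; exact: evolvesD.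
Qed.

Lemma evolves_expR f df : evolves f df ->
  evolves (fun t => expR (f t)) (fun t => df t * expR (f t)).
Proof.
move=> [cf hf]; split; first exact: contRge0_expR.
move=> t t0; rewrite mulrC.
by apply: (@is_derive1_comp _ expR); exact: hf.
Qed.

Lemma evolves_id : evolves (fun t : R => t) (fun=> 1).
Proof.
split; first by apply/contRge0P => t _; exact: cvg_within.
by move=> t _; exact: is_derive_id.
Qed.

Lemma evolves_MVT f df a b : evolves f df -> 0 <= a -> a < b ->
  exists2 c, a < c < b & f b - f a = df c * (b - a).
Proof.
move=> [cf hf] a0 ab.
have [c||c cab e] := @MVT _ f df _ _ ab.
- rewrite in_itv/= => /andP[ac cb].
  by apply: hf; exact: le_lt_trans ac.
- apply: continuous_subspaceW cf => x /=; rewrite !in_itv/= andbT => /andP[ax _].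
  exact: le_trans ax.
by exists c.
Qed.

Lemma evolves_ndecr f df a b : evolves f df -> 0 <= a -> a <= b ->
  (forall t, a < t < b -> 0 <= df t) -> f a <= f b.
Proof.
move=> hf a0; rewrite le_eqVlt => /predU1P[->//|ab] df0.
have [c cab e] := evolves_MVT hf a0 ab.
by rewrite -subr_ge0 e mulr_ge0 ?df0// subr_ge0 ltW.
Qed.

Lemma evolves_nincr f df a b : evolves f df -> 0 <= a -> a <= b ->
  (forall t, a < t < b -> df t <= 0) -> f b <= f a.
Proof.
move=> hf a0; rewrite le_eqVlt => /predU1P[->//|ab] df0.
have [c cab e] := evolves_MVT hf a0 ab.
by rewrite -subr_le0 e mulr_le0_ge0 ?df0// subr_ge0 ltW.
Qed.

Lemma evolves_constant f df : evolves f df -> (forall t : R, 0 < t -> df t = 0) ->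
  forall t : R, 0 <= t -> f t = f 0.
Proof.
move=> hf df0 t t0; apply/eqP; rewrite eq_le.
by rewrite (evolves_nincr hf)// ?(evolves_ndecr hf)// => s /andP[/df0 ->].
Qed.

End calculus.

Definition primitive0 (R : realType) (f : R -> R) (t : R) : R :=
  parameterized_integral lebesgue_measure 0 t f.

Lemma primitive0_0 (R : realType) (f : R -> R) : primitive0 f 0 = 0.
Proof. by rewrite /primitive0 /parameterized_integral set_itv1 Rintegral_set1. Qed.

Lemma evolves_primitive0 (R : realType) (f : R -> R) :
  {within `[0, +oo[, continuous f} -> evolves (primitive0 f) f.
Proof.
move=> cf.
have fi b : (@lebesgue_measure R).-integrable `[0, b] (EFin \o f).
  apply: continuous_compact_integrable; first exact: segment_compact.
  apply: continuous_subspaceW cf => x /=; rewrite !in_itv/= andbT.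
  by case/andP.
have /continuous_within_itvcyP[cf' _] := cf.
have df (t : R) : 0 < t -> is_derive t 1 (primitive0 f) (f t).
  move=> t0; have tt1 : t < t + 1 by rewrite ltrDl.
  have [] := continuous_FTC1_closed tt1 (fi _) t0.
    by apply: cf'; rewrite in_itv/= t0.
  move=> d e.
  by apply: DeriveDef => //; rewrite -derive1E.
split=> //.
apply/continuous_within_itvcyP; split.
  move=> t; rewrite in_itv/= andbT => t0.
  apply: differentiable_continuous; apply/derivable1_diffP.
  by have [] := df t t0.
have := parameterized_integral_continuous ler01 (fi 1).
by move=> /(continuous_within_itvP _ ltr01)[].
Qed.

(** * Euclidean norm, operator norm and quadratic forms *)

Section euclidean.
Variables (R : realType) (q : nat).
Implicit Types (u v x : 'cV[R]_q) (A K : 'M[R]_q).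

Definition dot u v : R := (u^T *m v) 0 0.

Lemma dotE u v : dot u v = \sum_i u i 0 * v i 0.
Proof. by rewrite /dot mxE; apply: eq_bigr => i _; rewrite mxE. Qed.

Lemma dotC u v : dot u v = dot v u.
Proof. by rewrite !dotE; apply: eq_bigr => i _; rewrite mulrC. Qed.

Lemma dotDr u v x : dot u (v + x) = dot u v + dot u x.
Proof. by rewrite /dot mulmxDr mxE. Qed.

Lemma dotZr u (a : R) v : dot u (a *: v) = a * dot u v.
Proof. by rewrite /dot -scalemxAr mxE. Qed.

Lemma dotDl u v x : dot (v + x) u = dot v u + dot x u.
Proof. by rewrite dotC dotDr !(dotC u). Qed.

Lemma dotZl u (a : R) v : dot (a *: v) u = a * dot v u.
Proof. by rewrite dotC dotZr (dotC u). Qed.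

Lemma dot_mulmx A u v : dot (A *m u) v = dot u (A^T *m v).
Proof. by rewrite /dot trmx_mul mulmxA. Qed.

Lemma dot_enorm x : dot x x = enorm x ^+ 2.
Proof.
rewrite /enorm sqr_sqrtr; last by apply: sumr_ge0 => i _; exact: sqr_ge0.
by rewrite dotE; apply: eq_bigr => i _; rewrite expr2.
Qed.

Lemma enorm_ge0 x : 0 <= enorm x. Proof. exact: sqrtr_ge0. Qed.

Lemma dot_ge0 x : 0 <= dot x x.
Proof. by rewrite dot_enorm sqr_ge0. Qed.

Lemma enorm_eq0 x : enorm x = 0 -> x = 0.
Proof.
move=> x0; have := dot_enorm x; rewrite x0 expr0n/= dotE => /eqP.
rewrite psumr_eq0 => [/allP h|i _]; last by rewrite -expr2 sqr_ge0.
apply/colP => i; rewrite mxE; have := h i (mem_index_enum i).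
by rewrite -expr2 sqrf_eq0 => /eqP.
Qed.

Lemma enorm0 : enorm (0 : 'cV[R]_q) = 0.
Proof. by rewrite /enorm big1 ?sqrtr0// => i _; rewrite mxE expr0n. Qed.

Lemma enormZ (a : R) x : enorm (a *: x) = `|a| * enorm x.
Proof.
apply/eqP; rewrite -(@eqrXn2 _ 2)// ?mulr_ge0 ?enorm_ge0//.
by rewrite exprMn -!dot_enorm dotZl dotZr mulrA real_normK ?num_real// expr2.
Qed.

(** Expanding the nonnegative [|b u - a v|^2] at [a := |u|], [b := |v|]
    leaves [2 a b (a b - u . v)]. *)
Lemma dot_le_enorm u v : dot u v <= enorm u * enorm v.
Proof.
have [/eqP|u0] := eqVneq (enorm u) 0.
  move/eqP/enorm_eq0 ->; rewrite -(scale0r (0 : 'cV_q)) dotZl enormZ.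
  by rewrite normr0 !mul0r.
have [/eqP|v0] := eqVneq (enorm v) 0.
  move/eqP/enorm_eq0 ->; rewrite -(scale0r (0 : 'cV_q)) dotZr enormZ.
  by rewrite normr0 !mul0r mulr0.
have {}u0 : 0 < enorm u by rewrite lt_neqAle eq_sym u0 enorm_ge0.
have {}v0 : 0 < enorm v by rewrite lt_neqAle eq_sym v0 enorm_ge0.
have := dot_ge0 (enorm v *: u + (- enorm u) *: v).
rewrite !(dotDl, dotDr, dotZl, dotZr) !dot_enorm (dotC v u) => h.
rewrite -subr_ge0 -(pmulr_rge0 _ (mulr_gt0 u0 v0)).
rewrite -(@pmulr_rge0 _ 2)//; apply: le_trans h _.
by rewrite le_eqVlt; apply/orP; left; apply/eqP; ring.
Qed.

Lemma enorm_triangle u v : enorm (u + v) <= enorm u + enorm v.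
Proof.
rewrite -(@ler_pXn2r _ 2)// ?nnegrE ?addr_ge0 ?enorm_ge0//.
rewrite -dot_enorm !(dotDl, dotDr) !dot_enorm (dotC v u) sqrrD.
have := dot_le_enorm u v; lra.
Qed.

Lemma coord_le_enorm x i : `|x i 0| <= enorm x.
Proof.
rewrite -(@ler_pXn2r _ 2)// ?nnegrE ?enorm_ge0//.
rewrite -dot_enorm dotE real_normK ?num_real// (bigD1 i)//= expr2 lerDl.
by apply: sumr_ge0 => j _; rewrite -expr2 sqr_ge0.
Qed.

Lemma enorm_le_sum x : enorm x <= \sum_i `|x i 0|.
Proof.
rewrite -(@ler_pXn2r _ 2)// ?nnegrE ?enorm_ge0 ?sumr_ge0//.
rewrite -dot_enorm dotE expr2 mulr_sumr; apply: ler_sum => i _.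
rewrite -expr2 -[leLHS]real_normK ?num_real// expr2 ler_wpM2r//.
by rewrite (bigD1 i)//= lerDl sumr_ge0.
Qed.

(** A bound for the operator norm that is a continuous function of the
    entries by construction. *)
Definition abs_sum A : R := \sum_i \sum_j `|A i j|.

Lemma abs_sum_ge0 A : 0 <= abs_sum A.
Proof. by apply: sumr_ge0 => i _; apply: sumr_ge0. Qed.

Lemma enorm_mulmx_le A x : enorm (A *m x) <= abs_sum A * enorm x.
Proof.
apply: le_trans (enorm_le_sum _) _; rewrite mulr_suml; apply: ler_sum => i _.
rewrite mxE; apply: le_trans (ler_norm_sum _ _ _) _.
rewrite mulr_suml; apply: ler_sum => j _.
by rewrite normrM ler_wpM2l// coord_le_enorm.
Qed.

Lemma opnorm_has_sup A :
  has_sup [set enorm (A *m x) | x in [set x : 'cV[R]_q | enorm x <= 1]].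
Proof.
split.
  by exists (enorm (A *m 0)); exists 0 => //=; rewrite enorm0.
exists (abs_sum A) => _ [x /= x1 <-].
by apply: le_trans (enorm_mulmx_le _ _) _; rewrite ler_piMr// abs_sum_ge0.
Qed.

Lemma opnorm_ge0 A : 0 <= opnorm A.
Proof.
apply: sup_upper_bound; first exact: opnorm_has_sup.
by exists 0; rewrite /= ?mulmx0 enorm0.
Qed.

Lemma enorm_mulmx A x : enorm (A *m x) <= opnorm A * enorm x.
Proof.
have [/enorm_eq0 ->|x0] := eqVneq (enorm x) 0.
  by rewrite mulmx0 enorm0 mulr0.
have {}x0 : 0 < enorm x by rewrite lt_neqAle eq_sym x0 enorm_ge0.
rewrite -ler_pdivrMr// mulrC -[(enorm x)^-1]gtr0_norm ?invr_gt0// -enormZ scalemxAr.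
apply: sup_upper_bound; first exact: opnorm_has_sup.
exists ((enorm x)^-1 *: x) => //=.
by rewrite enormZ gtr0_norm ?invr_gt0// mulVf// gt_eqF.
Qed.

Lemma opnorm_le A (c : R) : 0 <= c ->
  (forall x, enorm (A *m x) <= c * enorm x) -> opnorm A <= c.
Proof.
move=> c0 h; apply: sup_le_ub; first by have [] := opnorm_has_sup A.
by move=> _ [x /= x1 <-]; apply: le_trans (h x) _; rewrite ler_piMr.
Qed.

Lemma opnorm_le_add A K : opnorm A <= opnorm K + abs_sum (A - K).
Proof.
apply: opnorm_le => [|x]; first by rewrite addr_ge0 ?opnorm_ge0 ?abs_sum_ge0.
rewrite -{1}(subrK K A) addrC mulmxDl mulrDl.
apply: le_trans (enorm_triangle _ _) _.
by rewrite lerD ?enorm_mulmx ?enorm_mulmx_le.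
Qed.

Lemma enorm_delta (j : 'I_q) : enorm (delta_mx j 0 : 'cV[R]_q) = 1.
Proof.
rewrite /enorm (bigD1 j)//= mxE !eqxx expr1n big1 ?addr0 ?sqrtr1// => i ij.
by rewrite mxE (negbTE ij) expr0n.
Qed.

Lemma entry_le_opnorm A i j : `|A i j| <= opnorm A.
Proof.
have -> : A i j = (A *m (delta_mx j 0 : 'cV[R]_q)) i 0 by rewrite -colE mxE.
apply: le_trans (coord_le_enorm _ _) _.
by apply: le_trans (enorm_mulmx _ _) _; rewrite enorm_delta mulr1.
Qed.

(** With [v := K u], the hypothesis reads [c |v|^2 <= v . u <= |v| |u|]. *)
Lemma opnorm_inverse_le A K (c : R) : 0 < c -> A *m K = 1%:M ->
  (forall x, c * dot x x <= dot x (A *m x)) -> opnorm K <= c^-1.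
Proof.
move=> c0 AK h; apply: opnorm_le => [|u]; first by rewrite invr_ge0 ltW.
have := h (K *m u); rewrite mulmxA AK mul1mx.
have := dot_le_enorm (K *m u) u; rewrite dot_enorm.
have [->|K0] := eqVneq (enorm (K *m u)) 0.
  by rewrite mulr_ge0// ?enorm_ge0// invr_ge0 ltW.
have {}K0 : 0 < enorm (K *m u) by rewrite lt_neqAle eq_sym K0 enorm_ge0.
move=> h1 h2; rewrite -(ler_pM2l c0) mulrA divff ?gt_eqF// mul1r.
by rewrite -(ler_pM2l K0) (le_trans _ h1)// (le_trans _ h2)// expr2 mulrCA.
Qed.

(** Converse of [opnorm_inverse_le] for symmetric nonnegative [A]: the form
    of [A] is nonnegative at [x - mu^-1 K x], and there it equals
    [x . A x - 2 mu^-1 |x|^2 + mu^-2 x . K x], whose last term is at most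
    [mu^-1 |x|^2]. *)
Lemma inverse_opnorm_coercive A K (mu : R) : 0 < mu -> A^T = A ->
  (forall x, 0 <= dot x (A *m x)) -> A *m K = 1%:M -> opnorm K <= mu ->
  forall x, mu^-1 * dot x x <= dot x (A *m x).
Proof.
move=> mu0 symA A0 AK Kmu x.
have h1 : dot x (K *m x) <= mu * dot x x.
  apply: le_trans (dot_le_enorm _ _) _.
  rewrite dot_enorm expr2 mulrCA ler_wpM2l ?enorm_ge0//.
  by apply: le_trans (enorm_mulmx _ _) _; rewrite ler_wpM2r ?enorm_ge0.
have := A0 (x + (- mu^-1) *: (K *m x)).
rewrite mulmxDr -scalemxAr mulmxA AK mul1mx !(dotDl, dotDr, dotZl, dotZr).
rewrite (dotC (K *m x) (A *m x)) dot_mulmx symA mulmxA AK mul1mx (dotC _ x).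
move=> h2.
have h3 : mu^-1 * (mu^-1 * dot x (K *m x)) <= mu^-1 * dot x x.
  by rewrite ler_pM2l ?invr_gt0// ler_pdivrMl.
lra.
Qed.

Lemma definite_unitmx A :
  (forall x, dot x (A *m x) = 0 -> x = 0) -> A \in unitmx.
Proof.
move=> Ainj.
rewrite -unitmx_tr -row_free_unit -kermx_eq0; apply/eqP/row_matrixP => i.
rewrite row0; apply: trmx_inj; rewrite trmx0; apply: Ainj.
have -> : A *m (row i (kermx A^T))^T = 0.
  by apply: trmx_inj; rewrite trmx_mul trmxK -row_mul mulmx_ker row0 trmx0.
by rewrite /dot mulmx0 mxE.
Qed.

(** A compactness-free proof.  With [C > |A|], the form of [A] is
    nonnegative at [x - C^-1 A x], which gives [|A x|^2 <= C (x . A x)];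
    and [|x| <= |A^-1| |A x|]. *)
Lemma posdef_coercive A : A^T = A -> (forall x, 0 <= dot x (A *m x)) ->
  (forall x, dot x (A *m x) = 0 -> x = 0) ->
  exists2 c : R, 0 < c & forall x, c * dot x x <= dot x (A *m x).
Proof.
move=> symA A0 Ainj.
pose C := opnorm A + 1; have C0 : 0 < C by rewrite ltr_wpDl ?opnorm_ge0.
have hA x : C^-1 * dot (A *m x) (A *m x) <= dot x (A *m x).
  have := A0 (x + (- C^-1) *: (A *m x)).
  rewrite mulmxDr -scalemxAr !(dotDl, dotDr, dotZl, dotZr).
  have -> : dot x (A *m (A *m x)) = dot (A *m x) (A *m x) by rewrite dot_mulmx symA.
  have : dot (A *m x) (A *m (A *m x)) <= C * dot (A *m x) (A *m x).
    apply: le_trans (dot_le_enorm _ _) _.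
    rewrite dot_enorm expr2 mulrCA ler_wpM2l ?enorm_ge0//.
    apply: le_trans (enorm_mulmx _ _) _.
    by rewrite ler_wpM2r ?enorm_ge0// lerDl.
  rewrite -(ler_pdivrMl _ _ C0) -(@ler_pM2l _ C^-1) ?invr_gt0//.
  lra.
have uA := definite_unitmx Ainj.
pose k := opnorm (invmx A) + 1.
have k0 : 0 < k by rewrite ltr_wpDl ?opnorm_ge0.
exists (C^-1 * (k ^+ 2)^-1); first by rewrite mulr_gt0 ?invr_gt0 ?exprn_gt0.
move=> x; apply: le_trans (hA x); rewrite -mulrA ler_pM2l ?invr_gt0//.
rewrite ler_pdivrMl ?exprn_gt0// !dot_enorm -exprMn.
rewrite ler_pXn2r ?nnegrE ?mulr_ge0 ?enorm_ge0 ?(ltW k0)//.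
rewrite -{1}(mulKmx uA x); apply: le_trans (enorm_mulmx _ _) _.
by rewrite ler_wpM2r ?enorm_ge0// lerDl.
Qed.

Lemma det_entries_le A (b : R) : (forall i j, `|A i j| <= b) ->
  `|\det A| <= \sum_(s : 'S_q) b ^+ q.
Proof.
move=> h; apply: le_trans (ler_norm_sum _ _ _) _; apply: ler_sum => s _.
rewrite normrM normrX normrN1 expr1n mul1r normr_prod.
rewrite -[q in leRHS]card_ord -prodr_const; apply: ler_prod => i _.
by rewrite normr_ge0 h.
Qed.

End euclidean.

Lemma enorm_le_coord (R : realType) q (c : R) (u v : 'cV[R]_q) : 0 <= c ->
  (forall i, `|u i 0| <= c * `|v i 0|) -> enorm u <= c * enorm v.
Proof.
move=> c0 h; rewrite -(@ler_pXn2r _ 2)// ?nnegrE ?mulr_ge0 ?enorm_ge0//.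
rewrite exprMn -!dot_enorm !dotE mulr_sumr; apply: ler_sum => i _.
rewrite -!expr2 -exprMn -[leLHS]real_normK ?num_real//.
rewrite -[leRHS]real_normK ?num_real// ler_pXn2r ?nnegrE// normrM.
by rewrite (ger0_norm c0).
Qed.

(** [I - G = G S] because [G (I + S) = I], hence [(I - G)^-1 = I + S^-1];
    the entries of [I + S^-1] are at most [1 + c^-1] in modulus and so its determinant
    is bounded by a constant depending on [c] and [q] only. *)
Lemma det_sub_inverse_ge (R : realType) q (c : R) : 0 < c ->
  exists2 d : R, 0 < d & forall S G : 'M[R]_q,
    (forall x, c * dot x x <= dot x (S *m x)) -> G *m (1%:M + S) = 1%:M ->
    d <= `|\det (1%:M - G)|.
Proof.
move=> c0; pose B : R := \sum_(s : {perm 'I_q}) (1 + c^-1) ^+ q.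
have B0 : 0 < B.
  rewrite /B sumr_const pmulrn_lgt0 ?exprn_gt0 ?addr_gt0 ?invr_gt0//.
  by rewrite card_Sn fact_gt0.
exists B^-1; first by rewrite invr_gt0.
move=> S G hS GS.
have uS : S \in unitmx.
  apply: definite_unitmx => x x0; apply: enorm_eq0; apply/eqP.
  have := hS x; rewrite x0 pmulr_rle0// dot_enorm => h.
  by rewrite -sqrf_eq0 eq_le h sqr_ge0.
have hK := opnorm_inverse_le c0 (mulmxV uS) hS.
have inv : (1%:M - G) *m (1%:M + invmx S) = 1%:M.
  have -> : 1%:M - G = G *m S.
    by rewrite -[in LHS]GS mulmxDr mulmx1 addrC addKr.
  by rewrite -mulmxA mulmxDr mulmx1 mulmxV// addrC GS.
have hb : `|\det (1%:M + invmx S)| <= B.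
  apply: det_entries_le => i j; rewrite mxE; apply: le_trans (ler_normD _ _) _.
  apply: lerD; last by apply: le_trans hK; exact: entry_le_opnorm.
  by rewrite mxE; case: (i == j); rewrite ?normr1 ?normr0.
rewrite -[leLHS]mul1r ler_pdivrMr//.
have := congr1 determinant inv; rewrite det_mulmx det1 => dd.
apply: (@le_trans _ _ (`|\det (1%:M - G)| * `|\det (1%:M + invmx S)|)).
  by rewrite -normrM dd normr1.
by rewrite ler_wpM2l.
Qed.

Lemma contRge0_opnorm (R : realType) q (F : R -> 'M[R]_q) :
  (forall i j, {within `[0, +oo[, continuous (fun t => F t i j)}) ->
  {within `[0, +oo[, continuous (fun t => opnorm (F t))}.
Proof.
move=> cF; apply/contRge0P => t t0; apply/cvgrPdist_lt => e e0.
have cg : {within `[0, +oo[, continuous (fun s => abs_sum (F s - F t))}.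
  apply: contRge0_sum => i; apply: contRge0_sum => j; apply: contRge0_norm.
  have -> : (fun s => (F s - F t) i j) = (fun s => F s i j + - F t i j).
    by apply/funext => s; rewrite !mxE.
  by apply: contRge0D => //; exact: contRge0_cst.
have /cvgrPdist_lt/(_ e e0) := (contRge0P _).1 cg t t0.
apply: filterS => s.
have -> : abs_sum (F t - F t) = 0.
  by rewrite subrr /abs_sum big1// => i _; rewrite big1// => j _; rewrite mxE normr0.
rewrite sub0r normrN ger0_norm ?abs_sum_ge0//; apply: le_lt_trans.
have abs_sumC : abs_sum (F t - F s) = abs_sum (F s - F t).
  by do 2!(apply: eq_bigr => ? _); rewrite !mxE distrC.
have := opnorm_le_add (F s) (F t); have := opnorm_le_add (F t) (F s).
rewrite abs_sumC ler_norml; lra.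
Qed.

(** * Differential equations for matrices *)

Definition mevolves (R : realType) m n (A dA : R -> 'M[R]_(m, n)) : Prop :=
  forall i j, evolves (fun t => A t i j) (fun t => dA t i j).

Section matrix_calculus.
Variable R : realType.

Lemma mevolves_is_derive_on_Rge0 m n (A dA : R -> 'M[R]_(m, n)) :
  (forall t : R, 0 <= t -> is_derive_on_Rge0 A t (dA t)) -> mevolves A dA.
Proof.
move=> h i j; apply: evolves_is_derive_on_Rge0 => t t0.
exact/is_derive_on_Rge0_coord/h.
Qed.

Lemma mevolves_eq m n (A dA dB : R -> 'M[R]_(m, n)) :
  (forall t : R, 0 < t -> dA t = dB t) -> mevolves A dA -> mevolves A dB.
Proof. by move=> e hA i j; apply: evolves_eq (hA i j) => t /e ->. Qed.

Lemma mevolves_cst m n (A : 'M[R]_(m, n)) : mevolves (fun=> A) (fun=> 0).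
Proof.
move=> i j; under [X in evolves _ X]eq_fun do rewrite mxE.
exact: evolves_cst.
Qed.

Lemma mevolvesD m n (A B dA dB : R -> 'M[R]_(m, n)) :
  mevolves A dA -> mevolves B dB ->
  mevolves (fun t => A t + B t) (fun t => dA t + dB t).
Proof.
move=> hA hB i j; under eq_fun do rewrite mxE.
by under [X in evolves _ X]eq_fun do rewrite mxE; exact: evolvesD.
Qed.

Lemma mevolvesZ m n (f df : R -> R) (A dA : R -> 'M[R]_(m, n)) :
  evolves f df -> mevolves A dA ->
  mevolves (fun t => f t *: A t) (fun t => df t *: A t + f t *: dA t).
Proof.
move=> hf hA i j; under eq_fun do rewrite mxE.
by under [X in evolves _ X]eq_fun do rewrite !mxE; exact: evolvesM.
Qed.

Lemma mevolvesM m n p (A dA : R -> 'M[R]_(m, n)) (B dB : R -> 'M[R]_(n, p)) :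
  mevolves A dA -> mevolves B dB ->
  mevolves (fun t => A t *m B t) (fun t => dA t *m B t + A t *m dB t).
Proof.
move=> hA hB i j; under eq_fun do rewrite mxE.
under [X in evolves _ X]eq_fun do rewrite !mxE -big_split.
by apply: evolves_sum => k; exact: evolvesM.
Qed.

(** [V * exp (- primitive of c)] is nonincreasing and vanishes at [0]. *)
Lemma evolves_gronwall (V dV c : R -> R) : evolves V dV ->
  {within `[0, +oo[, continuous c} ->
  (forall t : R, 0 < t -> dV t <= c t * V t) -> V 0 = 0 ->
  forall t : R, 0 <= t -> V t <= 0.
Proof.
move=> hV cc hle V0 t t0.
have hE := evolves_expR (evolvesZ (-1) (evolves_primitive0 cc)).
have /= := evolves_nincr (evolvesM hV hE) (lexx 0) t0.
rewrite V0 mul0r => h; rewrite -(pmulr_lle0 _ (expR_gt0 (-1 * primitive0 c t))).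
apply: h => s /andP[s0 _].
set E := expR _.
have -> : dV s * E + V s * ((-1 * c s) * E) = (dV s - c s * V s) * E by ring.
by rewrite pmulr_lle0 ?expR_gt0// subr_le0 hle.
Qed.

(** Gronwall's inequality for the sum of the squares of the entries. *)
Lemma linear_ode_zero q p (A : R -> 'M[R]_q) (D : R -> 'M[R]_(q, p)) :
  (forall i j, {within `[0, +oo[, continuous (fun t => A t i j)}) ->
  mevolves D (fun t => A t *m D t) -> D 0 = 0 ->
  forall t : R, 0 <= t -> D t = 0.
Proof.
move=> cA hD D0.
pose V t := \sum_i \sum_j D t i j * D t i j.
have V_ge i j t : D t i j * D t i j <= V t.
  rewrite /V (bigD1 i)//= (bigD1 j)//= -addrA lerDl.
  rewrite addr_ge0 ?sumr_ge0// => [k _|k _].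
    by rewrite -expr2 sqr_ge0.
  by apply: sumr_ge0 => l _; rewrite -expr2 sqr_ge0.
have hV : evolves V (fun t => \sum_i \sum_j ((A t *m D t) i j * D t i j +
    D t i j * (A t *m D t) i j)).
  by apply: evolves_sum => i; apply: evolves_sum => j; apply: evolvesM.
pose c t := \sum_i \sum_(j < p) \sum_k (`|A t i k| + `|A t i k|).
have cc : {within `[0, +oo[, continuous c}.
  do 3!(apply: contRge0_sum => ?).
  by apply: contRge0D; apply: contRge0_norm.
have hle t : 0 < t -> \sum_i \sum_j ((A t *m D t) i j * D t i j +
    D t i j * (A t *m D t) i j) <= c t * V t.
  move=> t0; rewrite /c mulr_suml; apply: ler_sum => i _.
  rewrite mulr_suml; apply: ler_sum => j _.
  rewrite mxE mulr_suml mulr_sumr -big_split mulr_suml/=; apply: ler_sum => k _.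
  rewrite mulrC -mulrDl.
  have := V_ge i j t; have := V_ge k j t.
  set a := A t i k; set x := D t i j; set y := D t k j => hy hx.
  (* Both squares are at most [V t], hence so is [|x y|]. *)
  have hxy : `|x * y| <= V t.
    have := sqr_ge0 (x - y); have := sqr_ge0 (x + y).
    by rewrite ler_norml; nra.
  have : a * (x * y) <= `|a| * V t.
    apply: le_trans (ler_norm _) _; rewrite normrM ler_wpM2l//.
  lra.
have VE := evolves_gronwall hV cc hle.
have V0 : V 0 = 0.
  by rewrite /V big1// => i _; rewrite big1// => j _; rewrite D0 mxE mul0r.
move=> t t0; apply/matrixP => i j; rewrite mxE; apply/eqP.
rewrite -sqrf_eq0 eq_le sqr_ge0 andbT expr2.
exact: le_trans (V_ge i j t) (VE V0 t t0).
Qed.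

End matrix_calculus.

(** * Scalar equations and barriers *)

Lemma linear_decay_inverse (R : realType) (z b : R -> R) :
  {within `[0, +oo[, continuous b} -> evolves z (fun t => - (b t * z t)) ->
  z 0 = 1 -> forall t : R, 0 <= t -> z t * expR (primitive0 b t) = 1.
Proof.
move=> cb hz z0 t t0.
rewrite (evolves_constant (evolvesM hz (evolves_expR (evolves_primitive0 cb))) _ t0).
  by rewrite z0 primitive0_0 expR0 mul1r.
by move=> s _; ring.
Qed.

Lemma evolves_abs_nincr (R : realType) (w dw : R -> R) (a b : R) :
  evolves w dw -> 0 <= a -> a <= b ->
  (forall t, a < t < b -> w t * dw t <= 0) -> `|w b| <= `|w a|.
Proof.
move=> hw a0 ab hle.
rewrite -(@ler_pXn2r _ 2)// ?nnegrE// !real_normK ?num_real// !expr2.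
apply: (evolves_nincr (evolvesM hw hw) a0 ab) => t /hle.
by rewrite mulrC; lra.
Qed.

(** Before [T] the weight [exp (lam (T - t))] is at least [1] and [|w|] is
    nonincreasing; after [T], [|w t exp (lam t)|] is nonincreasing. *)
Lemma exponential_decay (R : realType) (w a : R -> R) (T lam : R) :
  evolves w (fun t => - (a t * w t)) -> 0 <= T -> 0 <= lam ->
  (forall t : R, 0 < t -> 0 <= a t) -> (forall t : R, T < t -> lam <= a t) ->
  forall t : R, 0 <= t -> `|w t| <= expR (lam * (T - t)) * `|w 0|.
Proof.
move=> hw T0 lam0 a0 alam t t0.
have nincr (b : R) : 0 <= b -> `|w b| <= `|w 0|.
  move=> b0; apply: (evolves_abs_nincr hw (lexx 0) b0) => s /andP[s0 _].
  by rewrite mulrN mulrCA -expr2 oppr_le0 mulr_ge0 ?sqr_ge0 ?a0.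
have [tT|Tt] := leP t T.
  apply: le_trans (nincr t t0) _; rewrite ler_peMl//.
  by rewrite -expR0 ler_expR mulr_ge0// subr_ge0.
have hu := evolvesM hw (evolves_expR (evolvesZ lam (@evolves_id R))).
have /= := evolves_abs_nincr hu T0 (ltW Tt).
rewrite !normrM !(gtr0_norm (expR_gt0 _)) mulrBr expRD => h.
rewrite -(ler_pM2r (expR_gt0 (lam * t))).
have -> : expR (lam * T) * expR (- (lam * t)) * `|w 0| * expR (lam * t) =
  `|w 0| * expR (lam * T) * expR (- (lam * t) + lam * t) by rewrite expRD; ring.
rewrite addNr expR0 mulr1.
apply: (le_trans (h _)); last by rewrite ler_wpM2r ?expR_ge0// nincr.
move=> s /andP[Ts _].
set E := expR _.
have -> : w s * E * (- (a s * w s) * E + w s * (lam * 1 * E)) =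
  - ((a s - lam) * (w s * E) ^+ 2) by ring.
by rewrite oppr_le0 mulr_ge0 ?sqr_ge0// subr_ge0 alam.
Qed.

(** If [h t > M], consider the last time before [t] at which [h <= M]. *)
Lemma continuous_barrier (R : realType) (h : R -> R) (M : R) :
  {within `[0, +oo[, continuous h} -> h 0 <= M ->
  (forall s t : R, 0 <= s -> s < t -> h s <= M ->
     (forall r, s < r -> r <= t -> M < h r) -> h t <= M) ->
  forall t : R, 0 <= t -> h t <= M.
Proof.
move=> /contRge0P ch h0 hM t t0; rewrite leNgt; apply/negP => Mht.
pose S := [set r | [/\ 0 <= r, r <= t & h r <= M]].
have S0 : S 0 by [].
have supS : has_sup S by split; [exists 0|exists t => r []].
have s0 : 0 <= sup S by exact: sup_upper_bound.
have st : sup S <= t by apply: sup_le_ub => [|r []//]; exists 0.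
have hs : h (sup S) <= M.
  rewrite leNgt; apply/negP => Mhs.
  have := ch _ s0; move/cvgrPdist_lt => /(_ (h (sup S) - M)).
  rewrite subr_gt0 => /(_ Mhs) H; rewrite near_withinE in H.
  have /nbhs_ballP[d /= d0 hd] := H.
  have [r [r0 rt hr] dr] := sup_adherent d0 supS.
  have rs : r <= sup S by exact: sup_upper_bound.
  have : `|h (sup S) - h r| < h (sup S) - M.
    apply: hd; last by rewrite in_itv/= r0.
    by rewrite /ball/= ger0_norm ?subr_ge0// ltrBlDr addrC -ltrBlDr.
  by move=> /(le_lt_trans (ler_norm _)); rewrite ltrD2l ltrN2 ltNge hr.
have {}st : sup S < t.
  rewrite lt_neqAle st andbT; apply/eqP => e.
  by move: hs; rewrite e leNgt Mht.
suff hS r : sup S < r -> r <= t -> M < h r.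
  by have := hM _ _ s0 st hs hS; rewrite leNgt Mht.
move=> sr rt; rewrite ltNge; apply/negP => hr.
move: (sr); rewrite ltNge => /negP; apply; apply: sup_upper_bound => //.
split => //; exact: le_trans s0 (ltW sr).
Qed.

(** * Excitation and the Riccati equation *)

Section gramian.
Variables (R : realType) (q : nat) (k : R -> R) (phi : R -> 'cV[R]_q).
Hypothesis k_cont : {within `[0, +oo[, continuous k}.
Hypothesis phi_cont : forall i, {within `[0, +oo[, continuous (fun t => phi t i 0)}.

Definition gramian (t : R) : 'M[R]_q :=
  \matrix_(i, j) primitive0 (fun s => k s * (phi s i 0 * phi s j 0)) t.

Lemma gramian0 : gramian 0 = 0.
Proof. by apply/matrixP => i j; rewrite !mxE primitive0_0. Qed.

Lemma tr_gramian t : (gramian t)^T = gramian t.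
Proof.
apply/matrixP => i j; rewrite !mxE; congr primitive0.
by apply/funext => s; rewrite [phi s i 0 * _]mulrC.
Qed.

Lemma mevolves_gramian :
  mevolves gramian (fun t => k t *: (phi t *m (phi t)^T)).
Proof.
move=> i j; under eq_fun do rewrite mxE.
under [X in evolves _ X]eq_fun do rewrite !mxE big_ord1 !mxE.
apply: evolves_primitive0; apply: contRge0M => //; exact: contRge0M.
Qed.

Lemma evolves_gramian_form (x : 'cV[R]_q) :
  evolves (fun t => dot x (gramian t *m x)) (fun t => k t * dot (phi t) x ^+ 2).
Proof.
have hx := mevolves_cst x; have hxT := mevolves_cst x^T.
have := mevolvesM hxT (mevolvesM mevolves_gramian hx) 0 0.
apply: evolves_eq => t _.
rewrite mul0mx add0r mulmx0 addr0 -scalemxAl -scalemxAr mxE; congr (_ * _).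
by rewrite !mulmxA -(mulmxA _ _ x) [LHS]mxE big_ord1 expr2 -{1}(dotC x).
Qed.

Hypothesis k_gt0 : forall t, 0 <= t -> 0 < k t.

Lemma gramian_form_ndecr x (s t : R) : 0 <= s -> s <= t ->
  dot x (gramian s *m x) <= dot x (gramian t *m x).
Proof.
move=> s0 st; apply: (evolves_ndecr (evolves_gramian_form x)) => // r /andP[sr _].
by rewrite mulr_ge0 ?sqr_ge0// ltW// k_gt0// (le_trans s0)// ltW.
Qed.

Lemma gramian_form_ge0 x (t : R) : 0 <= t -> 0 <= dot x (gramian t *m x).
Proof.
move=> t0; apply: le_trans (gramian_form_ndecr x (lexx 0) t0).
by rewrite gramian0 mul0mx /dot mulmx0 mxE.
Qed.

(** If the form vanishes at [x] at time [T], it vanishes on [[0, T]], being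
    nonnegative and nondecreasing; its derivative [k (phi . x)^2] then
    vanishes at the sampling times of the identifiability condition, where
    the vectors [phi] span the space. *)
Lemma gramian_coercive : identifiable phi ->
  exists2 T : R, 0 <= T & exists2 c : R, 0 < c &
    forall t x, T <= t -> c * dot x x <= dot x (gramian t *m x).
Proof.
move=> [tau tau0 rk].
pose T := 1 + \sum_j tau j.
have T0 : 0 <= T by rewrite addr_ge0// sumr_ge0// => j _; rewrite ltW.
have tauT j : tau j < T.
  rewrite /T (bigD1 j)//= addrCA ltrDl ltr_pwDl// sumr_ge0// => l _.
  by rewrite ltW.
exists T => //.
have [|x|x Qx0|c c0 hc] := @posdef_coercive _ _ (gramian T).
- exact: tr_gramian.
- exact: gramian_form_ge0.
- have h j : dot (phi (tau j)) x = 0.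
    have [_ dQ] := evolves_gramian_form x.
    (* [tau j] is an interior maximum of a form that is zero on [0, T]. *)
    have : is_derive (tau j) 1 (fun t => dot x (gramian t *m x)) 0.
      apply: (@derive1_at_max _ _ 0 T) => // [t||t].
      + by rewrite in_itv/= => /andP[/dQ[]].
      + by rewrite in_itv/= tau0 tauT.
      rewrite in_itv/= => /andP[t0 tT].
      apply: (@le_trans _ _ 0); last by rewrite gramian_form_ge0// ltW.
      by rewrite -Qx0 gramian_form_ndecr// ltW.
    move=> /@derive_val; have := dQ _ (tau0 j) => /@derive_val -> /eqP.
    by rewrite mulf_eq0 gt_eqF ?k_gt0 ?ltW//= sqrf_eq0 => /eqP.
  set Phi := (X in \rank X) in rk.
  have uPhi : Phi \in unitmx by rewrite -row_full_unit -col_leq_rank rk.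
  apply: trmx_inj; rewrite trmx0 -(mulmxK uPhi x^T).
  suff -> : x^T *m Phi = 0 by rewrite mul0mx.
  apply/rowP => j; rewrite [RHS]mxE -(h j) dotC dotE mxE.
  by apply: eq_bigr => i _; rewrite /Phi !mxE.
- exists c => // t x Tt; apply: le_trans (hc x) _.
  exact: gramian_form_ndecr.
Qed.

Section riccati.
Variable G : R -> 'M[R]_q.
Hypothesis G_ode :
  mevolves G (fun t => - (k t *: (G t *m phi t *m (phi t)^T *m G t))).
Hypothesis G0 : G 0 = 1%:M.

Let A t := - k t *: (G t *m phi t *m (phi t)^T).

Let A_cont i j : {within `[0, +oo[, continuous (fun t => A t i j)}.
Proof.
have -> : (fun t => A t i j) =
    (fun t => -1 * k t * ((\sum_l G t i l * phi t l 0) * phi t j 0)).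
  by apply/funext => t; rewrite !mxE big_ord1 !mxE mulN1r.
apply: contRge0M; first by apply: contRge0M => //; exact: contRge0_cst.
apply: contRge0M => //; apply: contRge0_sum => l; apply: contRge0M => //.
by have [] := G_ode i l.
Qed.

(** [W := G (I + S) - I] solves the linear equation [W' = A W] with [W 0 = 0]. *)
Lemma riccati_inverse (t : R) : 0 <= t -> G t *m (1%:M + gramian t) = 1%:M.
Proof.
move=> t0.
have hN := mevolvesD (mevolves_cst 1%:M) mevolves_gramian.
have hW := mevolvesD (mevolvesM G_ode hN) (mevolves_cst (- 1%:M)).
apply/eqP; rewrite -subr_eq0; apply/eqP.
apply: (linear_ode_zero (D := fun t => G t *m (1%:M + gramian t) - 1%:M)
          A_cont _ _ t0); last by rewrite G0 mul1mx gramian0 addr0 subrr.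
apply: mevolves_eq hW => s _.
rewrite /A add0r addr0 mulmxBr mulmx1 mulNmx !scaleNr opprK mulNmx -!scalemxAl.
by rewrite -scalemxAr !mulmxA.
Qed.

(** [e] and [G (e 0)] solve the same linear equation. *)
Lemma riccati_propagator (e : R -> 'cV[R]_q) :
  mevolves e (fun t => - (k t *: (G t *m phi t *m (phi t)^T *m e t))) ->
  forall t : R, 0 <= t -> e t = G t *m e 0.
Proof.
move=> he t t0.
have hGe := mevolvesM G_ode (mevolves_cst (- e 0)).
have hD := mevolvesD he hGe.
apply/eqP; rewrite -subr_eq0 -mulmxN; apply/eqP.
apply: (linear_ode_zero (D := fun t => e t + G t *m (- e 0)) A_cont _ _ t0);
  last by rewrite G0 mul1mx subrr.
apply: mevolves_eq hD => s _.
by rewrite /A mulmx0 addr0 mulmxDr scaleNr !mulNmx -!scalemxAl !mulmxA.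
Qed.

End riccati.

End gramian.

(** * Boundedness of signals *)

Lemma boundedRge0 (R : realType) (V : normedModType R) (f : R -> V) (c : R) :
  (forall t : R, 0 <= t -> `|f t| <= c) -> [bounded f t | t in `[0, +oo[].
Proof.
move=> h; exists c; split; first exact: num_real.
move=> x /ltW cx t /=; rewrite in_itv/= andbT => /h /le_trans; exact.
Qed.

Lemma mx_norm_le (R : realType) m n (A : 'M[R]_(m, n)) (c : R) :
  0 <= c -> (forall i j, `|A i j| <= c) -> `|A| <= c.
Proof.
move=> c0 h; rewrite /Num.norm/=.
have [->//|/mx_norm_neq0[[i j] ->]] := eqVneq (mx_norm A) 0.
exact: h.
Qed.

(** * The estimator *)

Theorem corollary1 (R : realType) (q : nat)
    (theta : 'cV[R]_q) (phi : R -> 'cV[R]_q) (y : R -> R)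
    (phi_continuous : {within `[0, +oo[, continuous phi})
    (yE : forall t, 0 <= t -> y t = ((phi t)^T *m theta) 0 0)
    (phi_identifiable : identifiable phi)
    (alpha f0 beta0 M gamma : R)
    (alpha_gt0 : 0 < alpha) (f0_gt0 : 0 < f0) (beta0_ge0 : 0 <= beta0)
    (M_ge : f0^-1 <= M) (gamma_gt0 : 0 < gamma)
    (eta0 theta0 : 'cV[R]_q)
    (heta : R -> 'cV[R]_q) (F : R -> 'M[R]_q) (htheta : R -> 'cV[R]_q)
    (z beta Delta : R -> R) (Y : R -> 'cV[R]_q)
    (betaE : forall t, 0 <= t -> beta t = beta0 * (1 - opnorm (F t) / M))
    (DeltaE : forall t, 0 <= t -> Delta t = \det (1%:M - (z t * f0) *: F t))
    (YE : forall t, 0 <= t ->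
       Y t = \adj (1%:M - (z t * f0) *: F t)
               *m (heta t - (z t * f0) *: F t *m eta0))
    (heta_ode : forall t, 0 <= t ->
       is_derive_on_Rge0 heta t
         ((y t - ((phi t)^T *m heta t) 0 0) *: (alpha *: (F t *m phi t))))
    (heta_init : heta 0 = eta0)
    (F_ode : forall t, 0 <= t ->
       is_derive_on_Rge0 F t
         (- (alpha *: (F t *m phi t *m (phi t)^T *m F t)) + beta t *: F t))
    (F_init : F 0 = (f0^-1)%:M)
    (htheta_ode : forall t, 0 <= t ->
       is_derive_on_Rge0 htheta t
         ((gamma * Delta t) *: (Y t - Delta t *: htheta t)))
    (htheta_init : htheta 0 = theta0)
    (z_ode : forall t, 0 <= t -> is_derive_on_Rge0 z t (- (beta t * z t)))
    (z_init : z 0 = 1) :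
  [/\ exists c lambda : R, [/\ 0 < c, 0 < lambda &
        forall t, 0 <= t -> enorm (htheta t - theta) <= c * expR (- (lambda * t))],
      [/\ [bounded heta t | t in `[0, +oo[],
          [bounded F t | t in `[0, +oo[],
          [bounded htheta t | t in `[0, +oo[] &
          [bounded z t | t in `[0, +oo[]],
      [/\ [bounded beta t | t in `[0, +oo[],
          [bounded Delta t | t in `[0, +oo[] &
          [bounded Y t | t in `[0, +oo[]] &
      forall (ta tb : R) (i : 'I_q), 0 <= tb -> tb <= ta ->
        `|(htheta ta - theta) i 0| <= `|(htheta tb - theta) i 0| ].
Proof.
have M0 : 0 < M by apply: lt_le_trans M_ge; rewrite invr_gt0.
have phi_cont i : {within `[0, +oo[, continuous (fun t => phi t i 0)}.
  apply/contRge0P => t t0.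
  have /contRge0P/(_ t t0) h := phi_continuous.
  rewrite (_ : (fun t => phi t i 0) = (fun v : 'cV[R]_q => v i 0) \o phi)//.
  by apply: cvg_comp; [exact: h|exact: coord_continuous].
have hF := mevolves_is_derive_on_Rge0 F_ode.
have hz := evolves_is_derive_on_Rge0 z_ode.
have cop : {within `[0, +oo[, continuous (fun t => opnorm (F t))}.
  by apply: contRge0_opnorm => i j; have [] := hF i j.
pose b t := beta0 * (1 + -1 * (opnorm (F t) * M^-1)).
have bE t : 0 <= t -> b t = beta t by move=> t0; rewrite betaE// /b mulN1r.
have cb : {within `[0, +oo[, continuous b}.
  apply: contRge0M; first exact: contRge0_cst.
  apply: contRge0D; first exact: contRge0_cst.
  apply: contRge0M; first exact: contRge0_cst.
  by apply: contRge0M => //; exact: contRge0_cst.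
(* [E] is [1 / z], in a form whose continuity and positivity are known. *)
pose E t := expR (primitive0 b t).
have zE t : 0 <= t -> z t * E t = 1.
  apply: linear_decay_inverse => //.
  by apply: evolves_eq hz => s s0; rewrite bE// ltW.
have z_gt0 t : 0 <= t -> 0 < z t.
  by move=> t0; rewrite -(pmulr_lgt0 _ (expR_gt0 (primitive0 b t))) zE.
pose k t := alpha / f0 * E t.
have k_gt0 t : 0 <= t -> 0 < k t.
  by move=> _; rewrite mulr_gt0 ?expR_gt0// divr_gt0.
have k_cont : {within `[0, +oo[, continuous k}.
  apply: contRge0M; first exact: contRge0_cst.
  apply: contRge0_expR; exact: (evolves_primitive0 cb).1.
have kE t : 0 <= t -> k t * (z t * f0) = alpha.
  move=> t0; have -> : k t * (z t * f0) = alpha * (z t * E t).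
    by rewrite /k; field; exact: lt0r_neq0.
  by rewrite zE// mulr1.
pose G t := (z t * f0) *: F t.
have hzf : evolves (fun t => z t * f0) (fun t => - (beta t * (z t * f0))).
  apply: evolves_eq (evolvesM hz (evolves_cst f0)) => t _; ring.
have G0 : G 0 = 1%:M.
  by rewrite /G z_init mul1r F_init scale_scalar_mx divff ?gt_eqF.
have G_ode : mevolves G (fun t => - (k t *: (G t *m phi t *m (phi t)^T *m G t))).
  apply: mevolves_eq (mevolvesZ hzf hF) => t t0.
  rewrite /G -!scalemxAl -scalemxAr !scalerA scalerDr scalerN !scalerA.
  rewrite kE ?ltW// [beta t * _]mulrC scaleNr addrCA addNr addr0.
  by rewrite [alpha * _]mulrC.
pose S := gramian k phi.
have GN t : 0 <= t -> G t *m (1%:M + S t) = 1%:M.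
  exact: (riccati_inverse k_cont phi_cont G_ode G0).
have he : mevolves (fun t => heta t - theta)
   (fun t => - (k t *: (G t *m phi t *m (phi t)^T *m (heta t - theta)))).
  have := mevolvesD (mevolves_is_derive_on_Rge0 heta_ode) (mevolves_cst (- theta)).
  apply: mevolves_eq => t t0; rewrite addr0 yE ?ltW//.
  have -> : ((phi t)^T *m theta) 0 0 - ((phi t)^T *m heta t) 0 0 =
      - dot (phi t) (heta t - theta).
    by rewrite dotDr -[- theta]scaleN1r dotZr /dot; ring.
  rewrite -[G t *m _ *m _ *m _]mulmxA.
  rewrite [(phi t)^T *m _]mx11_scalar -/(dot _ _) mul_mx_scalar.
  rewrite /G -scalemxAl !scalerA mulNr scaleNr; congr (- (_ *: _)).
  by rewrite -(kE t (ltW t0)); ring.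
have etaE t : 0 <= t -> heta t = theta + G t *m (eta0 - theta).
  move=> t0; rewrite -heta_init.
  by rewrite -(riccati_propagator k_cont phi_cont G_ode G0 he t0) addrC subrK.
have YDelta t : 0 <= t -> Y t = Delta t *: theta.
  move=> t0; rewrite YE// DeltaE// -/(G t) etaE//.
  have -> : theta + G t *m (eta0 - theta) - G t *m eta0 = (1%:M - G t) *m theta.
    by rewrite mulmxBr mulmxBl mul1mx addrA [X in X - _]addrAC addrK.
  by rewrite mulmxA mul_adj_mx mul_scalar_mx.
have S_ge0 t x : 0 <= t -> 0 <= dot x (S t *m x).
  exact: gramian_form_ge0.
have N_form t x : dot x ((1%:M + S t) *m x) = dot x x + dot x (S t *m x).
  by rewrite mulmxDl mul1mx dotDr.
have opG t : 0 <= t -> opnorm (G t) <= 1.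
  move=> t0; rewrite -invr1; apply: (@opnorm_inverse_le _ _ (1%:M + S t)) => //.
    exact/mulmx1C/GN.
  by move=> x; rewrite mul1r N_form lerDl S_ge0.
(* [P] is the inverse of [F]; bounds on [opnorm F] are read on its form. *)
pose P t := (z t * f0) *: (1%:M + S t).
have P_form t x : dot x (P t *m x) = z t * f0 * (dot x x + dot x (S t *m x)).
  by rewrite /P -scalemxAl dotZr N_form.
have PF t : 0 <= t -> P t *m F t = 1%:M.
  move=> t0; rewrite /P -scalemxAl scalemxAr; exact/mulmx1C/GN.
have opF t : 0 <= t -> opnorm (F t) <= M.
  apply: (continuous_barrier cop) => {t}.
    apply: le_trans M_ge; apply: opnorm_le => [|x].
      by rewrite invr_ge0 ltW.
    by rewrite F_init mul_scalar_mx enormZ ger0_norm// invr_ge0 ltW.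
  move=> s t s0 st Fs hM; have t0 : 0 <= t by rewrite (le_trans s0)// ltW.
  (* Above the threshold [M] the forgetting factor is nonpositive. *)
  have zst : z s <= z t.
    apply: (evolves_ndecr hz s0 (ltW st)) => r /andP[sr rt].
    have r0 : 0 < r by exact: le_lt_trans sr.
    rewrite oppr_ge0 pmulr_lle0 ?z_gt0 ?(ltW r0)// betaE ?(ltW r0)//.
    rewrite mulr_ge0_le0// subr_le0 ler_pdivlMr// mul1r.
    by rewrite (ltW (hM _ sr (ltW rt))).
  rewrite -(invrK M); apply: opnorm_inverse_le (PF t t0) _.
    by rewrite invr_gt0.
  move=> x; apply: (@le_trans _ _ (dot x (P s *m x))).
    apply: inverse_opnorm_coercive (PF s s0) Fs x => //.
      by rewrite /P linearZ/= linearD/= trmx1 tr_gramian.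
    move=> u; rewrite P_form mulr_ge0 ?addr_ge0 ?dot_ge0 ?S_ge0//.
    by rewrite mulr_ge0 ?ltW ?z_gt0.
  rewrite !P_form ler_pM ?addr_ge0 ?dot_ge0 ?S_ge0//.
  - by rewrite mulr_ge0 ?(ltW f0_gt0)// ltW// z_gt0.
  - by rewrite ler_pM2r.
  - by rewrite lerD2l gramian_form_ndecr// ltW.
have beta_itv t : 0 <= t -> 0 <= beta t <= beta0.
  move=> t0; rewrite betaE// mulr_ge0//=.
    by rewrite ler_piMr// gerBl divr_ge0 ?opnorm_ge0 ?(ltW M0).
  by rewrite subr_ge0 ler_pdivrMr// mul1r opF.
have zle1 t : 0 <= t -> z t <= 1.
  move=> t0; rewrite -z_init; apply: (evolves_nincr hz (lexx 0) t0) => r /andP[r0 _].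
  have /andP[b0 _] := beta_itv r (ltW r0).
  by rewrite oppr_le0 mulr_ge0// ltW// z_gt0// ltW.
have hw i : evolves (fun t => (htheta t - theta) i 0)
    (fun t => - (gamma * Delta t ^+ 2 * (htheta t - theta) i 0)).
  have := mevolvesD (mevolves_is_derive_on_Rge0 htheta_ode) (mevolves_cst (- theta)).
  move=> /(_ i 0); apply: evolves_eq => t t0.
  by rewrite addr0 YDelta ?ltW// !mxE; ring.
have rate_ge0 t : 0 <= gamma * Delta t ^+ 2 by rewrite mulr_ge0 ?sqr_ge0 ?ltW.
have mono (ta tb : R) (i : 'I_q) : 0 <= tb -> tb <= ta ->
    `|(htheta ta - theta) i 0| <= `|(htheta tb - theta) i 0|.
  move=> tb0 tab; apply: (evolves_abs_nincr (hw i) tb0 tab) => t _.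
  by rewrite mulrN mulrCA -expr2 oppr_le0 mulr_ge0 ?sqr_ge0.
have [T T0 [c c0 hS]] := gramian_coercive k_cont phi_cont k_gt0 phi_identifiable.
have [d d0 hd] := det_sub_inverse_ge q c0.
have Delta_ge t : T < t -> d <= `|Delta t|.
  move=> Tt; have t0 : 0 <= t by rewrite (le_trans T0)// ltW.
  rewrite DeltaE//; apply: hd (GN t t0) => x; apply: hS; exact: ltW.
have Delta_le t : 0 <= t -> `|Delta t| <= \sum_(s : {perm 'I_q}) 2 ^+ q.
  move=> t0; rewrite DeltaE//; apply: det_entries_le => i j.
  rewrite mxE; apply: le_trans (ler_normD _ _) _.
  rewrite (natrD _ 1 1) lerD//.
    by rewrite mxE; case: (i == j); rewrite ?normr1 ?normr0.
  by rewrite mxE normrN; apply: le_trans (opG t t0); exact: entry_le_opnorm.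
split => //.
- pose lam := gamma * d ^+ 2.
  have lam0 : 0 < lam by rewrite mulr_gt0 ?exprn_gt0.
  exists (expR (lam * T) * enorm (htheta 0 - theta) + 1), lam; split => //.
    by rewrite ltr_wpDl// mulr_ge0 ?expR_ge0 ?enorm_ge0.
  move=> t t0.
  have decay i : `|(htheta t - theta) i 0| <=
      expR (lam * (T - t)) * `|(htheta 0 - theta) i 0|.
    apply: (exponential_decay (hw i) T0 (ltW lam0)) t0 => [//|s Ts].
    rewrite ler_pM2l// -[leRHS]real_normK ?num_real//.
    by rewrite ler_pXn2r ?nnegrE ?(ltW d0)// Delta_ge.
  apply: le_trans (enorm_le_coord (expR_ge0 _) decay) _.
  rewrite mulrBr expRD mulrDl mul1r mulrAC lerDl expR_ge0//.
- split.
  + apply: (@boundedRge0 _ _ _ (enorm theta + enorm (eta0 - theta))) => t t0.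
    apply: mx_norm_le => [|i j]; first by rewrite addr_ge0 ?enorm_ge0.
    rewrite ord1 etaE//; apply: le_trans (coord_le_enorm _ _) _.
    apply: le_trans (enorm_triangle _ _) _; rewrite lerD2l.
    apply: le_trans (enorm_mulmx _ _) _.
    by rewrite ler_piMl ?enorm_ge0// opG.
  + apply: (@boundedRge0 _ _ _ M) => t t0.
    apply: mx_norm_le => [|i j]; first exact: ltW.
    by apply: le_trans (opF t t0); exact: entry_le_opnorm.
  + apply: (@boundedRge0 _ _ _ (enorm theta + enorm (theta0 - theta))) => t t0.
    apply: mx_norm_le => [|i j]; first by rewrite addr_ge0 ?enorm_ge0.
    rewrite ord1 -[htheta t](subrKC theta).
    rewrite [leLHS](_ : _ = `|theta i 0 + (htheta t - theta) i 0|).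
      apply: le_trans (ler_normD _ _) _; apply: lerD; first exact: coord_le_enorm.
      apply: le_trans (mono t 0 i (lexx 0) t0) _.
      by rewrite htheta_init coord_le_enorm.
    by rewrite mxE.
  + apply: (@boundedRge0 _ _ _ 1) => t t0.
    by rewrite ger0_norm ?zle1// ltW// z_gt0.
- split.
  + apply: (@boundedRge0 _ _ _ beta0) => t /beta_itv/andP[b0 b1].
    by rewrite ger0_norm.
  + exact: boundedRge0 Delta_le.
  + apply: (@boundedRge0 _ _ _ ((\sum_(s : {perm 'I_q}) 2 ^+ q) * `|theta|)) => t t0.
    by rewrite YDelta// normrZ ler_wpM2r// Delta_le.
Qed.
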